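(* Each of the eight disjoint subsets $\widetilde{\mathcal{L}}_k$, $k=1,\ldots,8$, of the lattice $L_0$ can be realized as a translate of a $4$-dilate of $L_0$ together with appropriate half-points in the following three ways: $$\text{I.}\quad \widetilde{\mathcal{L}}_k=\{\widetilde{a}_k+\Lambda_3\}\cup\Big\{\widetilde{a}_k+\tfrac{\omega_1^3+\omega_2^3}{2}+\Lambda_3\Big\},$$ $$\text{II.}\quad \widetilde{\mathcal{L}}_k=\{\widetilde{a}_k+\Lambda_4\}\cup\Big\{\widetilde{a}_k+\tfrac{\omega_2^4}{2}+\Lambda_4\Big\},$$ $$\text{III.}\quad \widetilde{\mathcal{L}}_k=\{\widetilde{a}_k+\Lambda_2\}\cup\Big\{\widetilde{a}_k+\tfrac{\omega_1^2}{2}+\Lambda_2\Big\}.$$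
   Context: $[a,b]=\mathbb{Z}a+\mathbb{Z}b$; $\rho=e^{2\pi i/3}$, $\omega=\rho+1=e^{i\pi/3}$. $L_0=[\omega_1,\omega_2]=\omega_1[1,\rho]$ with $\omega_1\ne0$, $\omega_2=\rho\omega_1$. For $k=1,\ldots,8$ let $(s_k,t_k)$ be respectively $(0,0),(1,0),(2,0),(3,0),(0,1),(1,1),(2,1),(3,1)$, let $\widetilde{a}_k=s_k\omega_1+t_k\omega_2$, and let $\widetilde{\mathcal{L}}_k=\widetilde{a}_k+\omega_1[4,2\omega]\subset L_0$. The upper indices below are labels, not exponents. The lattices with chosen bases are $\Lambda_3=[\omega_1^3,\omega_2^3]$ with $(\omega_1^3,\omega_2^3)=(4\omega_1,4\omega_2)$; $\Lambda_4=[\omega_1^4,\omega_2^4]$ with $(\omega_1^4,\omega_2^4)=(\omega_2^3,-\omega_1^3-\omega_2^3)$; $\Lambda_2=[\omega_1^2,\omega_2^2]$ with $(\omega_1^2,\omega_2^2)=(-\omega_1^3-\omega_2^3,\omega_1^3)$. *)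

(* Defs.v *)
(* MathComp / MathComp-Analysis; the complex plane is R[i] for R : realType. *)
From HB Require Import structures.
From mathcomp Require Import all_boot all_order all_algebra.
From mathcomp Require Import all_classical all_reals all_analysis.
From mathcomp Require Import complex.

Set Implicit Arguments.
Unset Strict Implicit.
Unset Printing Implicit Defensive.

Import Order.TTheory GRing.Theory Num.Theory.

Local Open Scope classical_set_scope.
Local Open Scope ring_scope.
Local Open Scope complex_scope.

(* exp (x + i y) = e^x (cos y + i sin y) *)
Definition cexp (R : realType) (z : R[i]) : R[i] :=
  (expR (complex.Re z))%:C * (cos (complex.Im z) +i* sin (complex.Im z)).

Definition rho (R : realType) : R[i] := cexp (2 * pi%:C * 'i%C / 3).

Definition omega (R : realType) : R[i] := rho R + 1.

(* [a, b] = Z a + Z b *)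
Definition zspan (R : realType) (a b : R[i]) : set R[i] :=
  [set z | exists m n : int, z = a *~ m + b *~ n].

Definition translate (R : realType) (a : R[i]) (A : set R[i]) : set R[i] :=
  [set a + z | z in A].

Definition dilate (R : realType) (c : R[i]) (A : set R[i]) : set R[i] :=
  [set c * z | z in A].

(* The index k : 'I_8 stands for the label k + 1 in 1, ..., 8. *)
Definition st (k : 'I_8) : nat * nat :=
  tnth [tuple (0, 0); (1, 0); (2, 0); (3, 0); (0, 1); (1, 1); (2, 1); (3, 1)]%N
       k.

Section Lattices.
Variables (R : realType) (w1 w2 : R[i]).

Definition L0 : set R[i] := zspan w1 w2.

Definition atilde (k : 'I_8) : R[i] := (st k).1%:R * w1 + (st k).2%:R * w2.

Definition Ltilde (k : 'I_8) : set R[i] :=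
  translate (atilde k) (dilate w1 (zspan 4 (2 * omega R))).

(* wi_j is the basis vector omega_i with upper label j. *)
Definition w1_3 : R[i] := 4 * w1.
Definition w2_3 : R[i] := 4 * w2.
Definition Lambda3 : set R[i] := zspan w1_3 w2_3.

Definition w1_4 : R[i] := w2_3.
Definition w2_4 : R[i] := - w1_3 - w2_3.
Definition Lambda4 : set R[i] := zspan w1_4 w2_4.

Definition w1_2 : R[i] := - w1_3 - w2_3.
Definition w2_2 : R[i] := w1_3.
Definition Lambda2 : set R[i] := zspan w1_2 w2_2.

End Lattices.

(* Main.v *)
Require Import Defs.
From HB Require Import structures.
From mathcomp Require Import all_boot all_order all_algebra.
From mathcomp Require Import all_classical all_reals all_analysis.
From mathcomp Require Import complex.
From mathcomp Require Import zify ring lra.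

Import Order.TTheory GRing.Theory Num.Theory.

Local Open Scope classical_set_scope.
Local Open Scope ring_scope.
Local Open Scope complex_scope.

(** Everything happens in the coordinates of the basis [w1, w2] of [L0].  Since
    [w1 * omega = w1 + w2], the set [Ltilde k] is the translate by [atilde k] of
    the lattice spanned by [4 w1] and [h = 2 (w1 + w2)] ([LtildeE]).  The three
    lattices [Lambda3], [Lambda4], [Lambda2] are one and the same lattice
    [4 L0], given by three bases, and in each case the half-point is [h] or
    [- h].  As [h] is half of a member of a basis of [4 L0], adjoining it to
    [4 L0] gives a lattice of index 2 over [4 L0], the union of the cosets of
    [0] and [h] ([zspan_half]); this lattice is spanned by [4 w1] and [h], so
    the three decompositions are this coset decomposition translated by
    [atilde k].

    For the disjointness, the coordinates are unique because [rho] is not real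
    ([zspan_free]), and membership in [Ltilde k] fixes [t] modulo 2 and, for a
    given [t], fixes [s] modulo 4; the eight pairs [(s_k, t_k)] are distinct
    and satisfy [s_k < 4] and [t_k < 2]. *)

(** * Lattices spanned by two vectors *)

Section Zspan.
Context {R : realType}.
Implicit Types a b c d h x y : R[i].

Lemma zspan_sub a b c d :
  zspan c d a -> zspan c d b -> zspan a b `<=` zspan c d.
Proof.
move=> [m [n ->]] [m' [n' ->]] z [p [q ->]].
exists (m * p + m' * q), (n * p + n' * q).
by rewrite !mulrzDr !mulrzA; ring.
Qed.

Lemma zspan_eq a b c d :
  zspan c d a -> zspan c d b -> zspan a b c -> zspan a b d ->
  zspan a b = zspan c d.
Proof. by move=> ca cb ac ad; apply/seteqP; split; exact: zspan_sub. Qed.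

Lemma dilate_zspan c a b : dilate c (zspan a b) = zspan (c * a) (c * b).
Proof.
apply/seteqP; split=> [_ [_ [m [n ->]] <-]|_ [m [n ->]]].
  by exists m, n; rewrite mulrDr !mulrzAr.
by exists (a *~ m + b *~ n); [exists m, n | rewrite mulrDr !mulrzAr].
Qed.

Lemma translateU x (A B : set R[i]) :
  translate x (A `|` B) = translate x A `|` translate x B.
Proof. exact: image_setU. Qed.

Lemma translateD x y (A : set R[i]) :
  translate (x + y) A = translate x (translate y A).
Proof.
rewrite /translate image_comp; congr (_ @` _).
by apply/funext => z /=; rewrite addrA.
Qed.

(** The coefficient of [h] in a member of [zspan a h] is even or odd; these two
    cases give the two cosets of the index 2 sublattice [zspan a (2 * h)]. *)
Lemma zspan_half a h :
  zspan a h = zspan a (2 * h) `|` translate h (zspan a (2 * h)).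
Proof.
apply/seteqP; split=> [_ [m [n ->]]|_ [[m [n ->]]|[_ [m [n ->]] <-]]].
- have [e|e] : n = 2 * (n %/ 2)%Z \/ n = 1 + 2 * (n %/ 2)%Z by lia.
    by left; exists m, (n %/ 2)%Z; rewrite {1}e mulrzA; ring.
  right; exists (a *~ m + (2 * h) *~ (n %/ 2)%Z); first by exists m, (n %/ 2)%Z.
  by rewrite {2}e; ring.
- by exists m, (2 * n); ring.
- by exists m, (1 + 2 * n); ring.
Qed.

(** The coset decomposition does not depend on bases: [a] and [h] only have to
    be such that [a] and [2 * h] span [L], while the overlattice [L + Z h] may be
    presented by any other basis. *)
Lemma translate_zspan_half x a h c d (L : set R[i]) :
  L = zspan a (2 * h) -> zspan a h = zspan c d ->
  translate x (zspan c d) = translate x L `|` translate (x + h) L.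
Proof. by move=> -> <-; rewrite translateD -translateU -zspan_half. Qed.

End Zspan.

(** * Coordinates in the hexagonal lattice *)

Section Hexagonal.
Context {R : realType}.

(** [rho] is a positive multiple of [cos x + i sin x] for [x = 2 pi / 3], which
    lies strictly between 0 and [pi]. *)
Lemma Im_rho_gt0 : 0 < complex.Im (rho R).
Proof.
have argE : 2 * pi%:C * 'i%C / 3 = 0 +i* (2 * pi / 3 : R).
  apply: (mulIf (_ : 3 != 0)); first by rewrite pnatr_eq0.
  rewrite mulfVK ?pnatr_eq0 //.
  by apply/eqP; rewrite eq_complex /=; apply/andP; split; apply/eqP => /=; field.
rewrite /rho /cexp argE /= expR0 mul1r mul0r addr0.
by apply: sin_gt0_pi; have := pi_gt0 R; lra.
Qed.

(** Divided by [w1], the relation reads [m + n rho = 0]; its imaginary part gives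
    [n = 0]. *)
Lemma zspan_free (w1 w2 : R[i]) (m n : int) :
  w1 != 0 -> w2 = rho R * w1 -> w1 *~ m + w2 *~ n = 0 -> m = 0 /\ n = 0.
Proof.
move=> w1_neq0 -> mn0.
have {mn0} mn0 : m%:~R + rho R * n%:~R = 0.
  apply: (mulfI w1_neq0); rewrite mulr0 -[RHS]mn0.
  by ring.
have n0 : n = 0.
  have := congr1 (@complex.Im R) mn0; rewrite mulrzr !raddfD /= !raddfMz /=.
  rewrite mul0rz add0r => /eqP; rewrite mulrz_eq0 (gt_eqF Im_rho_gt0) orbF.
  by move/eqP.
split=> //; apply/eqP; rewrite -(intr_eq0 R[i]).
by rewrite -[X in _ == X]mn0 n0 mulr0 addr0.
Qed.

(** The generators [4 w1] and [2 w1 omega] of the lattice in the definition of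
    [Ltilde], with [w1 omega = w1 + w2] expanded. *)
Lemma LtildeE (w1 w2 : R[i]) k : w2 = rho R * w1 ->
  Ltilde w1 w2 k =
  translate (atilde w1 w2 k) (zspan (4 * w1) (2 * (w1 + w2))).
Proof.
move=> w2E; rewrite /Ltilde dilate_zspan /omega w2E.
by congr (translate _ (zspan _ _)); ring.
Qed.

Lemma LtildeP {w1 w2 : R[i]} {k z} : w2 = rho R * w1 -> Ltilde w1 w2 k z ->
  exists m n : int, z = w1 *~ ((st k).1%:Z + 4 * m + 2 * n)
                      + w2 *~ ((st k).2%:Z + 2 * n).
Proof.
move=> w2E; rewrite LtildeE // => -[_ [m [n ->]] <-]; exists m, n.
by rewrite /atilde; ring.
Qed.

Lemma Ltilde_sub_L0 (w1 w2 : R[i]) k : w2 = rho R * w1 ->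
  Ltilde w1 w2 k `<=` L0 w1 w2.
Proof. by move=> w2E z /(LtildeP w2E) [m [n ->]]; do 2!eexists. Qed.

Lemma st_inj : injective st.
Proof. exact/tuple_uniqP. Qed.

Lemma st_bound k : ((st k).1 < 4)%N && ((st k).2 < 2)%N.
Proof.
by apply: (all_tnthP (a := fun p : nat * nat => (p.1 < 4) && (p.2 < 2))%N).
Qed.

Lemma Ltilde_trivIset (w1 w2 : R[i]) : w1 != 0 -> w2 = rho R * w1 ->
  trivIset [set: 'I_8] (Ltilde w1 w2).
Proof.
move=> w1_neq0 w2E i j _ _ [z [/(LtildeP w2E) [m [n zi]]]].
move=> /(LtildeP w2E) [m' [n' zj]]; apply: st_inj.
have [|e1 e2] := zspan_free w1 w2
  (((st i).1%:Z + 4 * m + 2 * n) - ((st j).1%:Z + 4 * m' + 2 * n'))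
  (((st i).2%:Z + 2 * n) - ((st j).2%:Z + 2 * n')) w1_neq0 w2E.
  by apply/eqP; rewrite !mulrzBr addrACA -opprD -zi -zj subrr.
have /andP[] := st_bound i; have /andP[] := st_bound j.
case: (st i) (st j) e1 e2 => [s t] [s' t'] /= e1 e2 *.
(* The second coordinates give t = t' and n = n', then the first ones give
   s = s' modulo 4. *)
have tt' : t = t' by lia.
have ss' : s = s' by lia.
by rewrite ss' tt'.
Qed.

(** * Coset decompositions over the dilated lattice *)

Lemma Lambda3E (w1 w2 : R[i]) : Lambda3 w1 w2 = dilate 4 (L0 w1 w2).
Proof. by rewrite dilate_zspan. Qed.

Lemma Lambda4E (w1 w2 : R[i]) : Lambda4 w1 w2 = dilate 4 (L0 w1 w2).
Proof.
rewrite dilate_zspan /Lambda4 /w1_4 /w2_4 /w1_3 /w2_3; apply: zspan_eq.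
- by exists 0, 1; ring.
- by exists (-1), (-1); ring.
- by exists (-1), (-1); ring.
- by exists 1, 0; ring.
Qed.

Lemma Lambda2E (w1 w2 : R[i]) : Lambda2 w1 w2 = dilate 4 (L0 w1 w2).
Proof.
rewrite dilate_zspan /Lambda2 /w1_2 /w2_2 /w1_3 /w2_3; apply: zspan_eq.
- by exists (-1), (-1); ring.
- by exists 1, 0; ring.
- by exists 0, 1; ring.
- by exists (-1), (-1); ring.
Qed.

(** The half-points of the three decompositions are [2 (w1 + w2)] and its
    opposite; either one generates the same overlattice of [4 L0], and with
    [4 w1] it spans that overlattice while its double and [4 w1] span [4 L0]. *)
Lemma Ltilde_half (w1 w2 h : R[i]) k : w2 = rho R * w1 ->
  h = 2 * (w1 + w2) \/ h = - (2 * (w1 + w2)) ->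
  Ltilde w1 w2 k =
  translate (atilde w1 w2 k) (dilate 4 (L0 w1 w2)) `|`
  translate (atilde w1 w2 k + h) (dilate 4 (L0 w1 w2)).
Proof.
move=> w2E hE; rewrite LtildeE //.
apply: (translate_zspan_half _ (4 * w1)); last first.
  case: hE => -> //; apply: zspan_eq.
  - by exists 1, 0; ring.
  - by exists 0, (-1); ring.
  - by exists 1, 0; ring.
  - by exists 0, (-1); ring.
rewrite dilate_zspan; case: hE => ->; apply: zspan_eq.
- by exists 1, 0; ring.
- by exists (-1), 1; ring.
- by exists 1, 0; ring.
- by exists 1, 1; ring.
- by exists 1, 0; ring.
- by exists (-1), (-1); ring.
- by exists 1, 0; ring.
- by exists (-1), (-1); ring.
Qed.

End Hexagonal.

Theorem mainTheorem10 (R : realType) (w1 w2 : R[i])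
    (w1_neq0 : w1 != 0) (w2E : w2 = rho R * w1) :
  [/\ trivIset [set: 'I_8] (Ltilde w1 w2),
      forall k : 'I_8, Ltilde w1 w2 k `<=` L0 w1 w2,
      [/\ Lambda3 w1 w2 = dilate 4 (L0 w1 w2),
          Lambda4 w1 w2 = dilate 4 (L0 w1 w2)
        & Lambda2 w1 w2 = dilate 4 (L0 w1 w2)]
    & forall k : 'I_8,
      [/\ Ltilde w1 w2 k =
            translate (atilde w1 w2 k) (Lambda3 w1 w2) `|`
            translate (atilde w1 w2 k + (w1_3 w1 + w2_3 w2) / 2)
                      (Lambda3 w1 w2),
          Ltilde w1 w2 k =
            translate (atilde w1 w2 k) (Lambda4 w1 w2) `|`
            translate (atilde w1 w2 k + w2_4 w1 w2 / 2) (Lambda4 w1 w2)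
        & Ltilde w1 w2 k =
            translate (atilde w1 w2 k) (Lambda2 w1 w2) `|`
            translate (atilde w1 w2 k + w1_2 w1 w2 / 2) (Lambda2 w1 w2)]].

Proof.
split.
- exact: Ltilde_trivIset.
- by move=> k; exact: Ltilde_sub_L0.
- by rewrite Lambda3E Lambda4E Lambda2E.
- move=> k; rewrite Lambda3E Lambda4E Lambda2E.
  by split; apply: Ltilde_half => //; rewrite /w2_4 /w1_2 /w1_3 /w2_3;
    [left | right | right]; field.
Qed.
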